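(* Let $(\lambda_n)_{n\ge 3}$ be a sequence of positive real numbers, and for $n\ge 3$ let $F_n^{(\lambda_n)}$ be the event, defined in the context, that the random majority graph $\widehat G_n$ differs from $G_n$. If $$\liminf_{n\to\infty}\frac{\lambda_n}{n^3} > 16\ln 2 ,$$ then there exist $K>0$ and $\beta>0$ such that, for every integer $n\ge 3$, $$\mathbb{P}\big(F_n^{(\lambda_n)}\big) < K e^{-\beta n}.$$ Therefore, $\lim_{n\to\infty}\mathbb{P}\big(F_n^{(\lambda_n)}\big)=0$.
   Context: For a positive integer $m$, $[m]=\{1,\dots,m\}$. A voting profile on a finite set $V$ of candidates is a matrix each of whose rows (preference lists, one per voter) is a permutation of the elements of $V$; its size $\#R$ is its number of rows. The majority graph of $R$ is the directed graph with vertex set $V$ in which $(a,b)$, $a\neq b$, is an arrow if and only if $a$ precedes $b$ in more than half of the rows of $R$; $R$ generates $G$ if $G$ is the majority graph of $R$. Graph $G_3=([8],E_3)$: $E_3$ consists of the 28 arrows $(1,2),(1,3),(1,5),(2,3),(2,4),(2,6),(2,7),$ $(3,4),(3,5),(3,6),(3,8),(4,1),(4,5),(4,8),$ $(5,2),(5,6),(5,7),(6,1),(6,4),(6,7),(6,8),$ $(7,1),(7,3),(7,4),(7,8),(8,1),(8,2),(8,5).$ Graph $G_n=([2^n],E_n)$ for $n\ge 4$: for $q\in[2^{n-3}]$ let $C_q=[8q]\setminus[8(q-1)]$; these classes partition $[2^n]$. For $i,j$ in the same class $C_q$, $(i,j)\in E_n$ if and only if $(i-8(q-1),j-8(q-1))\in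 E_3$. For $i<j$ in different classes, $(i,j)\in E_n$ if $i+j$ is even, and $(j,i)\in E_n$ if $i+j$ is odd. Profile $R_3$ on $[8]$ has the ten rows, in order: $(8,1,5,2,3,4,6,7)$, $(2,7,6,4,1,3,5,8)$, $(2,7,3,6,4,5,8,1)$, $(4,1,3,8,5,6,7,2)$, $(3,5,2,6,7,1,4,8)$, $(6,8,4,1,5,7,2,3)$, $(6,7,3,4,8,1,2,5)$, $(8,5,2,7,1,4,3,6)$, $(7,8,5,6,3,4,1,2)$, $(1,2,3,4,5,6,7,8)$. Operations: for row vectors, $(u_1,\dots,u_N)$ denotes concatenation, and $\bar u$ is $u$ in reverse order. For matrices with the same number of columns, $(M_1,\dots,M_N)_V$ is the matrix obtained by stacking all the rows of $M_1,\dots,M_N$ vertically in this order. $R+a\cdot\boldsymbol{1}$ is $R$ with $a$ added to every entry. For profiles $R^{(1)},R^{(2)}$ on disjoint candidate sets with the same even size $2r$, $R^{(1)}\bowtie R^{(2)}$ is the profile of size $2r$ on the union of the candidate sets whose $s$-th row is $(R^{(1)}_{s,\cdot},R^{(2)}_{s,\cdot})$ for $s$ odd and $(R^{(2)}_{s,\cdot},R^{(1)}_{s,\cdot})$ for $s$ even. For $n\ge 4$ define the vectors (entries in increasing order) $A^{(n)}_1=(1,3,\dots,2^{n-1}-1)$, $B^{(n)}_1=(2^{n-1}+1,2^{n-1}+3,\dots,2^n-1)$, $A^{(n)}_2=(2,4,\dots,2^{n-1})$, $B^{(n)}_2=(2^{n-1}+2,2^{n-1}+4,\dots,2^n)$,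 and the preference lists $v^{(n)}_1=(A^{(n)}_1,B^{(n)}_1,A^{(n)}_2,B^{(n)}_2)$, $v^{(n)}_2=(\bar A^{(n)}_2,\bar B^{(n)}_2,\bar A^{(n)}_1,\bar B^{(n)}_1)$, $v^{(n)}_3=(B^{(n)}_1,A^{(n)}_2,B^{(n)}_2,A^{(n)}_1)$, $v^{(n)}_4=(\bar B^{(n)}_2,\bar A^{(n)}_1,\bar B^{(n)}_1,\bar A^{(n)}_2)$. Recursively, for $n\ge 4$, $$R_n=\Big(v^{(n)}_1,v^{(n)}_2,v^{(n)}_3,v^{(n)}_4,\big[R_{n-1}\bowtie(R_{n-1}+2^{n-1}\cdot\boldsymbol{1})\big]\Big)_V ,$$ a voting profile on $[2^n]$ with $4n-2$ rows. Random profile: for $n\ge3$ the number of voters is a Poisson random variable with parameter $\lambda_n$, and each voter selects, independently and uniformly at random, one of the $4n-2$ rows of $R_n$. Let $W^{(n)}_\ell$ be the number of voters who selected the $\ell$-th row, $\ell\in[4n-2]$; equivalently (by Poisson thinning), $W^{(n)}_1,\dots,W^{(n)}_{4n-2}$ are independent Poisson random variables with parameter $\lambda_n/(4n-2)$. The random voting profile $\hat R_n$ has, for each $\ell\in[4n-2]$, exactly $W^{(n)}_\ell$ rows equal to the $\ell$-th row of $R_n$. $\widehat G_n=\widehat G_n(W^{(n)}_1,\dots,W^{(n)}_{4n-2})$ is the majority graph of $\hat R_n$ on $[2^n]$, and $F_n^{(\lambda_n)}=\{\widehat G_n\neq G_n\}$. *)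

(* Defs.v *)
From HB Require Import structures.
From mathcomp Require Import all_boot all_order all_algebra.
From mathcomp Require Import all_classical all_reals all_analysis.

Set Implicit Arguments.
Unset Strict Implicit.
Unset Printing Implicit Defensive.

Import Order.TTheory GRing.Theory Num.Theory.
Import numFieldNormedType.Exports.

Local Open Scope classical_set_scope.
Local Open Scope nat_scope.

Record digraph := Digraph { vertices : set nat; arrows : set (nat * nat) }.

(* [m] = {1, ..., m} *)
Definition initial_segment (m : nat) : set nat := [set i | 1 <= i <= m].

(* A profile is the list of its rows. *)
Definition profile := seq (seq nat).

Definition precedes (a b : nat) (row : seq nat) : bool :=
  index a row < index b row.

Definition majority_graph (V : set nat) (R : profile) : digraph :=
  Digraph V [set e | [/\ V e.1, V e.2, e.1 != e.2 &
                         size R < 2 * count (precedes e.1 e.2) R]].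

Definition E3 : seq (nat * nat) :=
  [:: (1,2); (1,3); (1,5); (2,3); (2,4); (2,6); (2,7);
      (3,4); (3,5); (3,6); (3,8); (4,1); (4,5); (4,8);
      (5,2); (5,6); (5,7); (6,1); (6,4); (6,7); (6,8);
      (7,1); (7,3); (7,4); (7,8); (8,1); (8,2); (8,5)].

(* The class C_q = {8(q-1)+1, ..., 8q} containing i >= 1 has q - 1 = block i. *)
Definition block (i : nat) : nat := i.-1 %/ 8.

Definition arrowG (i j : nat) : bool :=
  if block i == block j then
    (i - 8 * block i, j - 8 * block j) \in E3
  else if i < j then ~~ odd (i + j) else odd (i + j).

(* For n = 3 there is a single class, and the arrows are exactly E3. *)
Definition G (n : nat) : digraph :=
  Digraph (initial_segment (2 ^ n))
    [set e | [/\ initial_segment (2 ^ n) e.1, initial_segment (2 ^ n) e.2 &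
                 arrowG e.1 e.2]].

Definition R3 : profile :=
  [:: [:: 8; 1; 5; 2; 3; 4; 6; 7];
      [:: 2; 7; 6; 4; 1; 3; 5; 8];
      [:: 2; 7; 3; 6; 4; 5; 8; 1];
      [:: 4; 1; 3; 8; 5; 6; 7; 2];
      [:: 3; 5; 2; 6; 7; 1; 4; 8];
      [:: 6; 8; 4; 1; 5; 7; 2; 3];
      [:: 6; 7; 3; 4; 8; 1; 2; 5];
      [:: 8; 5; 2; 7; 1; 4; 3; 6];
      [:: 7; 8; 5; 6; 3; 4; 1; 2];
      [:: 1; 2; 3; 4; 5; 6; 7; 8]].

Definition shift (a : nat) (R : profile) : profile :=
  [seq [seq x + a | x <- row] | row <- R].

(* Rows are 0-indexed here, so that the order is swapped for s odd. *)
Definition bowtie (R1 R2 : profile) : profile :=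
  mkseq (fun s => if odd s then nth [::] R2 s ++ nth [::] R1 s
                  else nth [::] R1 s ++ nth [::] R2 s) (size R1).

Definition lowers (n : nat) : seq nat := iota 1 (2 ^ n.-1).
Definition uppers (n : nat) : seq nat := iota (2 ^ n.-1).+1 (2 ^ n.-1).

Definition A1 (n : nat) : seq nat := [seq i <- lowers n | odd i].
Definition B1 (n : nat) : seq nat := [seq i <- uppers n | odd i].
Definition A2 (n : nat) : seq nat := [seq i <- lowers n | ~~ odd i].
Definition B2 (n : nat) : seq nat := [seq i <- uppers n | ~~ odd i].

Definition v1 (n : nat) : seq nat := A1 n ++ B1 n ++ A2 n ++ B2 n.
Definition v2 (n : nat) : seq nat :=
  rev (A2 n) ++ rev (B2 n) ++ rev (A1 n) ++ rev (B1 n).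
Definition v3 (n : nat) : seq nat := B1 n ++ A2 n ++ B2 n ++ A1 n.
Definition v4 (n : nat) : seq nat :=
  rev (B2 n) ++ rev (A1 n) ++ rev (B1 n) ++ rev (A2 n).

(* Only meaningful for n >= 3; the value for n < 3 is a dummy. *)
Fixpoint Rn (n : nat) : profile :=
  if n is n'.+1 then
    if n <= 3 then R3
    else [:: v1 n; v2 n; v3 n; v4 n] ++ bowtie (Rn n') (shift (2 ^ n') (Rn n'))
  else R3.

Section probability.
Context {d : measure_display} {T : measurableType d} {R : realType}.
Variable P : probability T R.

Definition mutually_independent (I : eqType) {d' : measure_display}
    {U : measurableType d'} (Y : I -> {RV P >-> U}) : Prop :=
  forall (s : seq I) (A : I -> set U), uniq s ->
    (forall i, measurable (A i)) ->
    P (\bigcap_(i in [set` s]) (Y i @^-1` A i)) =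
    (\prod_(i <- s) P (Y i @^-1` A i))%E.

(* N is the number of voters and X k the (1-based) index of the row selected
   by voter k; only the voters k < N actually vote.  The index None of the
   independent family stands for N, the index Some k for X k. *)
Definition poisson_voting (lambda : R) (L : nat)
    (N : {RV P >-> nat}) (X : nat -> {RV P >-> nat}) : Prop :=
  [/\ forall k : nat, P (N @^-1` [set k]) = (poisson_pmf lambda k)%:E,
      forall k l : nat, 1 <= l <= L ->
        P (X k @^-1` [set l]) = ((L%:R : R)^-1%R)%:E &
      mutually_independent (fun i : option nat => if i is Some k then X k else N)].

Definition votes (N : {RV P >-> nat}) (X : nat -> {RV P >-> nat})
    (l : nat) (w : T) : nat :=
  \sum_(k < N w) (X k w == l).

Definition random_profile (n : nat)
    (N : {RV P >-> nat}) (X : nat -> {RV P >-> nat}) (w : T) : profile :=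
  flatten [seq nseq (votes N X l w) (nth [::] (Rn n) l.-1)
          | l <- iota 1 (4 * n - 2)].

Definition random_graph (n : nat)
    (N : {RV P >-> nat}) (X : nat -> {RV P >-> nat}) (w : T) : digraph :=
  majority_graph (initial_segment (2 ^ n)) (random_profile n N X w).

Definition failure (n : nat)
    (N : {RV P >-> nat}) (X : nat -> {RV P >-> nat}) : set T :=
  [set w | random_graph n N X w <> G n].

End probability.

(* Main.v *)
(* Every arrow (a, b) of G_n is supported by at least 2n of the 4n - 2 rows of
   R_n: the recursion adds two supporting rows when a and b lie in the same half
   (v1 and v2, and likewise v3 and v4, restrict to opposite orders there), while
   across the halves the bowtie splits evenly and three of v1, ..., v4 agree with
   G_n.  As G_n is a tournament, the random graph can differ from it only by
   losing an arrow.  By independence, weighting a vote for row l by u l turns the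
   sum over all ballot sequences of length m into the m-th power of the mean
   weight theta, and Poisson averaging gives the Chernoff bound
   exp(lambda (theta - 1)) for the loss of an arrow; suitable weights make this at
   most exp(- lambda / (8 n^2)).  A union bound over 4^n = exp(2 n ln 2) pairs
   leaves an exponentially small quantity as soon as lambda > 16 ln 2 n^3. *)
Require Import Defs.
From HB Require Import structures.
From mathcomp Require Import all_boot all_order all_algebra.
From mathcomp Require Import all_classical all_reals all_analysis.
From mathcomp Require Import zify ring lra.

Import Order.TTheory GRing.Theory Num.Theory.
Import numFieldNormedType.Exports.

Local Open Scope classical_set_scope.
Local Open Scope ring_scope.

(** * Precedence in a list *)

Section precedes.
Local Open Scope nat_scope.
Implicit Types (a b y : nat) (s t : seq nat).

Lemma precedes_cons a b y s :
  precedes a b (y :: s) = (y != b) && ((y == a) || precedes a b s).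
Proof.
by rewrite /precedes /=; case: (y == b); case: (y == a); rewrite ?ltn0 ?ltnS.
Qed.

(** An absent element has index [size s], so it counts as coming after every present one; hence the
    implication in the first branch. *)
Lemma precedes_cat a b s t : precedes a b (s ++ t) =
  if a \in s then (b \in s) ==> precedes a b s
  else (b \notin s) && precedes a b t.
Proof.
rewrite /precedes !index_cat.
case: (boolP (a \in s)) => as_; case: (boolP (b \in s)) => bs //=.
- by rewrite ltn_addr// index_mem.
- by rewrite ltnNge (leq_trans (ltnW _) (leq_addr _ _))// index_mem.
- by rewrite ltn_add2l.
Qed.

Lemma precedes_map (f : nat -> nat) a b s : injective f ->
  precedes (f a) (f b) (map f s) = precedes a b s.
Proof. by move=> f_inj; rewrite /precedes !index_map. Qed.

Lemma precedes_asym a b s : precedes a b s -> ~~ precedes b a s.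
Proof. by rewrite /precedes -leqNgt; exact: ltnW. Qed.

(** Equal indices would put [b] in [s] at the position of [a], forcing [a = b]; an absent [b] simply
    comes after [a]. *)
Lemma precedesC a b s : a != b -> a \in s ->
  precedes b a s = ~~ precedes a b s.
Proof.
move=> ab as_; rewrite /precedes -leqNgt ltn_neqAle andb_idl// => _.
apply: contra ab => /eqP ba; have bs : b \in s by rewrite -index_mem ba index_mem.
by rewrite -(nth_index 0 bs) ba nth_index.
Qed.

Lemma precedes_rev a b s : uniq s -> a != b -> a \in s -> b \in s ->
  precedes a b (rev s) = precedes b a s.
Proof.
move=> + ab; elim: s => //= y s IH /andP[ys us].
rewrite !inE rev_cons -cats1 precedes_cat !mem_rev precedes_cons.
have [ay|ay] /= := eqVneq a y.
  rewrite -ay in ys *; rewrite [b == a]eq_sym (negbTE ab) /= => _ bs.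
  by rewrite (negbTE ys) bs precedes_cons eqxx.
rewrite !precedes_cons [y == a]eq_sym [y == b]eq_sym ay /= => as_.
have [->|by_] /= := eqVneq b y; first by rewrite (negbTE ys) as_.
by move=> bs; rewrite as_ bs IH.
Qed.
End precedes.

(** * Rows of the recursive profiles and counting in a bowtie *)

Section majority.
Local Open Scope nat_scope.
Implicit Types (a b k n : nat) (row : seq nat).

Lemma size_bowtie (R1 R2 : profile) : size (bowtie R1 R2) = size R1.
Proof. by rewrite size_mkseq. Qed.

Lemma RnS n : 3 <= n -> Rn n.+1 =
  [:: v1 n.+1; v2 n.+1; v3 n.+1; v4 n.+1] ++
  bowtie (Rn n) (Defs.shift (2 ^ n) (Rn n)).
Proof. by move=> n3; rewrite [LHS]/= ltnNge n3. Qed.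

Lemma size_Rn n : 3 <= n -> size (Rn n) = 4 * n - 2.
Proof.
elim: n => // n IH; rewrite leq_eqVlt => /predU1P[<- //|n3].
by rewrite RnS// size_cat size_bowtie IH//= ; lia.
Qed.

Lemma mem_bowtie (R1 R2 : profile) row : size R1 = size R2 ->
  row \in bowtie R1 R2 -> exists r1 r2, [/\ r1 \in R1, r2 \in R2 &
    row = r1 ++ r2 \/ row = r2 ++ r1].
Proof.
move=> eqR /(nthP [::])[s]; rewrite size_bowtie => sR.
rewrite nth_mkseq// => <-.
exists (nth [::] R1 s), (nth [::] R2 s); split; rewrite ?mem_nth -?eqR//.
by case: odd; [right|left].
Qed.

Lemma mem_shift a (R : profile) row x : row \in Defs.shift a R ->
  exists2 r, r \in R & (x \in row) = (a <= x) && (x - a \in r).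
Proof.
move=> /mapP[r rR ->]; exists r => //.
apply/mapP/andP => [[y yr ->]|[ax xr]]; first by rewrite leq_addl addnK.
by exists (x - a); rewrite ?subnK.
Qed.

Lemma expn2S n : 2 ^ n.+1 = 2 ^ n + 2 ^ n.
Proof. by rewrite expnS mul2n addnn. Qed.

Lemma mem_A1 n x : (x \in A1 n.+1) = odd x && (1 <= x <= 2 ^ n).
Proof. by rewrite mem_filter mem_iota add1n ltnS. Qed.

Lemma mem_A2 n x : (x \in A2 n.+1) = ~~ odd x && (1 <= x <= 2 ^ n).
Proof. by rewrite mem_filter mem_iota add1n ltnS. Qed.

Lemma mem_B1 n x :
  (x \in B1 n.+1) = odd x && (2 ^ n < x <= 2 ^ n + 2 ^ n).
Proof. by rewrite mem_filter mem_iota addSn ltnS. Qed.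

Lemma mem_B2 n x :
  (x \in B2 n.+1) = ~~ odd x && (2 ^ n < x <= 2 ^ n + 2 ^ n).
Proof. by rewrite mem_filter mem_iota addSn ltnS. Qed.

Definition mem_AB := (mem_A1, mem_A2, mem_B1, mem_B2).

Lemma mem_Rn n row x : 3 <= n -> row \in Rn n ->
  (x \in row) = (1 <= x <= 2 ^ n).
Proof.
elim: n row x => // n IH row x; rewrite leq_eqVlt => /predU1P[<-|n3].
  have : all (perm_eq (iota 1 8)) R3 by [].
  by move=> /allP R3_perm /R3_perm /perm_mem <-; rewrite mem_iota.
rewrite RnS// mem_cat => /orP[|/mem_bowtie[|r1 [r2 [r1R /mem_shift r2R rowE]]]].
- rewrite !inE expn2S => /or4P[]/eqP->;
    rewrite !mem_cat ?mem_rev !mem_AB; case: (odd x); lia.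
- by rewrite size_map.
- have [r rR xr2] := r2R x.
  have -> : (x \in row) = (x \in r1) || (x \in r2).
    by case: rowE => ->; rewrite mem_cat// orbC.
  by rewrite xr2 !IH// expn2S; lia.
Qed.

Lemma mem_shift_Rn n row x : 3 <= n -> row \in Defs.shift (2 ^ n) (Rn n) ->
  (x \in row) = (2 ^ n < x <= 2 ^ n + 2 ^ n).
Proof.
by move=> n3 /mem_shift -/(_ x)[r rR ->]; rewrite (mem_Rn _ _ _ n3)//; lia.
Qed.

Lemma eq_count_nth {S T : Type} (x0 : S) (y0 : T) (p : pred S) (q : pred T) s t :
  size s = size t ->
  (forall i, i < size s -> p (nth x0 s i) = q (nth y0 t i)) ->
  count p s = count q t.
Proof.
elim: s t => [|x s IH] [|y t] //= [st] pq.
by rewrite (pq 0 isT) (IH t)// => i; exact: (pq i.+1).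
Qed.

(** A block containing neither [a] nor [b] cannot affect their order, whichever side it is put
    on. *)
Lemma count_bowtie_left a b (R1 R2 : profile) : size R1 = size R2 ->
  {in R1, forall r, (a \in r) && (b \in r)} ->
  {in R2, forall r, (a \notin r) && (b \notin r)} ->
  count (precedes a b) (bowtie R1 R2) = count (precedes a b) R1.
Proof.
move=> eqR abR1 abR2; apply: (eq_count_nth [::] [::]); rewrite size_bowtie// => s sR.
have /abR1/andP[ar1 br1] := mem_nth [::] sR.
have /abR2/andP[/negbTE ar2 /negbTE br2] :
  nth [::] R2 s \in R2 by rewrite mem_nth// -eqR.
rewrite nth_mkseq//.
by case: odd; rewrite precedes_cat ?br2 ?ar2 ?br1 ?ar1.
Qed.

Lemma count_bowtie_right a b (R1 R2 : profile) : size R1 = size R2 ->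
  {in R1, forall r, (a \notin r) && (b \notin r)} ->
  {in R2, forall r, (a \in r) && (b \in r)} ->
  count (precedes a b) (bowtie R1 R2) = count (precedes a b) R2.
Proof.
move=> eqR abR1 abR2; apply: (eq_count_nth [::] [::]); rewrite size_bowtie// => s sR.
have /abR2/andP[ar2 br2] : nth [::] R2 s \in R2 by rewrite mem_nth// -eqR.
have /abR1/andP[/negbTE ar1 /negbTE br1] := mem_nth [::] sR.
rewrite nth_mkseq//.
by case: odd; rewrite precedes_cat ?br1 ?ar1 ?br2 ?ar2.
Qed.

Lemma count_odd_iota k : count odd (iota 0 k.*2) = k.
Proof.
elim: k => // k IH; rewrite doubleS -addn2 iotaD count_cat IH add0n /=.
by rewrite odd_double /= addn1.
Qed.

Lemma count_bowtie_cross a b k (R1 R2 : profile) : size R1 = size R2 ->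
  size R1 = k.*2 ->
  {in R1, forall r, (a \in r) && (b \notin r)} ->
  {in R2, forall r, (a \notin r) && (b \in r)} ->
  count (precedes a b) (bowtie R1 R2) = k /\
  count (precedes b a) (bowtie R1 R2) = k.
Proof.
move=> eqR kR abR1 abR2.
have ba : count (precedes b a) (bowtie R1 R2) = k.
  (* With 0-indexed rows, the block of [b] comes first exactly in the odd rows, which are [k] of the
     [k.*2]. *)
  rewrite -[RHS]count_odd_iota; apply: (eq_count_nth [::] 0).
    by rewrite size_bowtie size_iota.
  rewrite size_bowtie => s sR; rewrite nth_mkseq// nth_iota -?kR// add0n.
  have /abR1/andP[ar1 br1] := mem_nth [::] sR.
  have /abR2/andP[/negbTE ar2 br2] : nth [::] R2 s \in R2.
    by rewrite mem_nth// -eqR.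
  by case: odd; rewrite precedes_cat ?br2 ?ar2 ?ar1 ?(negbTE br1).
(* Every row contains [a], so the two orders are complementary and the other count is also [k]. *)
suff baC : count (precedes b a) (bowtie R1 R2) =
    count (predC (precedes a b)) (bowtie R1 R2).
  split=> //; have := count_predC (precedes a b) (bowtie R1 R2).
  by rewrite -baC ba size_bowtie kR -addnn => /addIn.
apply: eq_in_count => r /mem_bowtie[]// r1 [r2 [/abR1/andP[ar1 br1]]].
move=> /abR2/andP[ar2 br2] rE; apply: precedesC.
  by apply: contraNneq br1 => <-.
by case: rE => ->; rewrite mem_cat ar1 ?orbT.
Qed.

(** * Arrows of $G_n$ and the rows that support them *)

Lemma arrowG_irrefl a : arrowG a a = false.
Proof.
rewrite /arrowG eqxx; apply/negbTE/negP => aa.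
have /allP/(_ _ aa) : all (fun e => e.1 != e.2) E3 by [].
by rewrite eqxx.
Qed.

Lemma block_small a : 1 <= a <= 8 -> block a = 0.
Proof. by move=> a8; rewrite /block divn_small//; lia. Qed.

Lemma arrowG_total a b : 1 <= a -> 1 <= b -> a != b -> arrowG a b || arrowG b a.
Proof.
move=> a1 b1 ab; rewrite /arrowG [block b == _]eq_sym; case: eqP => [ab8|_].
  (* Inside a class, [E3] is checked to be total by computation on the 64 pairs of offsets; across
     classes parity decides. *)
  have : all (fun x => all (fun y => (x != y) ==>
      ((x, y) \in E3) || ((y, x) \in E3)) (iota 1 8)) (iota 1 8) by [].
  move=> /allP/(_ (a - 8 * block a)) ha.
  have /ha/allP/(_ (b - 8 * block b)) : a - 8 * block a \in iota 1 8.
    by rewrite mem_iota /block; lia.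
  rewrite mem_iota ab8 => hb.
  suff : a - 8 * block b != b - 8 * block b.
    by move=> neq; move: hb; rewrite neq; apply; rewrite /block; lia.
  by move: ab8 ab; rewrite /block => + /eqP ab; move=> h; apply/eqP; lia.
rewrite [b + a]addnC; case: ltngtP ab => // _ _; case: odd => //.
Qed.

(** Translation by a multiple of 8 permutes the classes in order and keeps the parity of the sum.
    This identifies the upper half of the next graph with a copy of the previous one. *)
Lemma arrowG_add a b k : 1 <= a -> 1 <= b ->
  arrowG (a + 8 * k) (b + 8 * k) = arrowG a b.
Proof.
have blockD x : 1 <= x -> block (x + 8 * k) = block x + k by rewrite /block; lia.
move=> a1 b1; rewrite /arrowG !blockD// eqn_add2r !mulnDr !subnDr ltn_add2r.
by rewrite addnACA oddD addnn odd_double addbF.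
Qed.

Lemma count_v_same_half n a b : a != b ->
  (1 <= a <= 2 ^ n) && (1 <= b <= 2 ^ n) ||
  (2 ^ n < a <= 2 ^ n + 2 ^ n) && (2 ^ n < b <= 2 ^ n + 2 ^ n) ->
  count (precedes a b) [:: v1 n.+1; v2 n.+1; v3 n.+1; v4 n.+1] = 2.
Proof.
move=> ab /orP half; rewrite /= /v1 /v2 /v3 /v4.
rewrite !(precedes_cat, mem_cat, mem_rev, mem_AB).
(* For candidates of equal parity, the common list and its reversal contribute one row per pair of
   lists; different parities are settled by the order of the four lists. *)
have abX s : uniq s -> a \in s -> b \in s ->
    precedes a b s + precedes a b (rev s) = 1.
  by move=> us as_ bs; rewrite precedes_rev// (precedesC _ _ _ ab as_);
    case: precedes.
have := abX _ (filter_uniq odd (iota_uniq 1 (2 ^ n))).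
have := abX _ (filter_uniq odd (iota_uniq (2 ^ n).+1 (2 ^ n))).
have := abX _ (filter_uniq (predC odd) (iota_uniq 1 (2 ^ n))).
have := abX _ (filter_uniq (predC odd) (iota_uniq (2 ^ n).+1 (2 ^ n))).
rewrite -/(A1 n.+1) -/(A2 n.+1) -/(B1 n.+1) -/(B2 n.+1) !mem_AB.
case: half => /andP[ha hb].
  have -> : (2 ^ n < a <= 2 ^ n + 2 ^ n) = false by lia.
  have -> : (2 ^ n < b <= 2 ^ n + 2 ^ n) = false by lia.
  rewrite ha hb; case: (odd a); case: (odd b) => //= _; do ?move=> /(_ isT isT);
    lia.
have -> : (1 <= a <= 2 ^ n) = false by lia.
have -> : (1 <= b <= 2 ^ n) = false by lia.
rewrite ha hb; case: (odd a); case: (odd b) => //=; do ?move=> /(_ isT isT); lia.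
Qed.

(** The two candidates lie in different lists among [A1], [A2], [B1], [B2], so the arrangement of
    these lists alone decides; the majority of three follows the parity rule of $G_n$. *)
Lemma count_v_cross n a b :
  1 <= a <= 2 ^ n -> 2 ^ n < b <= 2 ^ n + 2 ^ n ->
  count (precedes a b) [:: v1 n.+1; v2 n.+1; v3 n.+1; v4 n.+1] =
    (if odd (a + b) then 1 else 3) /\
  count (precedes b a) [:: v1 n.+1; v2 n.+1; v3 n.+1; v4 n.+1] =
    (if odd (a + b) then 3 else 1).
Proof.
move=> ha hb; rewrite /= /v1 /v2 /v3 /v4.
rewrite !(precedes_cat, mem_cat, mem_rev, mem_AB).
have -> : (2 ^ n < a <= 2 ^ n + 2 ^ n) = false by lia.
have -> : (1 <= b <= 2 ^ n) = false by lia.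
by rewrite ha hb oddD; case: (odd a); case: (odd b).
Qed.

(** The support of at least $2(n+1)$ rows arises as $2 + 2n$ inside a half and as $3 + (2n-1)$
    across the halves; the base case is a computation on [R3]. *)
Lemma count_arrow n a b : 3 <= n -> 1 <= a <= 2 ^ n -> 1 <= b <= 2 ^ n ->
  arrowG a b -> 2 * n <= count (precedes a b) (Rn n).
Proof.
elim: n a b => // n IH a b; rewrite leq_eqVlt => /predU1P[<-|n3] aV bV ab.
  have : (a, b) \in E3.
    by move: ab; rewrite /arrowG !block_small//= !subn0.
  have : all (fun e => 6 <= count (precedes e.1 e.2) R3) E3 by [].
  by move=> /allP; apply.
have neq : a != b by apply: contraTneq ab => ->; rewrite arrowG_irrefl.
rewrite RnS// count_cat.
(* As 8 divides $2^n$, no class straddles the two halves, so arrows across them obey the parity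
   rule. *)
have [k k8] : exists k, 2 ^ n = 8 * k.
  by exists (2 ^ (n - 3)); rewrite -(expnD 2 3) subnKC.
move: aV bV; rewrite expn2S => aV bV.
have eqR : size (Rn n) = size (Defs.shift (2 ^ n) (Rn n)) by rewrite size_map.
have arrowE x y : 1 <= x <= 2 ^ n -> 2 ^ n < y -> (block x == block y) = false.
  by rewrite k8 /block => *; apply/eqP; lia.
have [a_low|a_up] := leqP a (2 ^ n); have [b_low|b_up] := leqP b (2 ^ n).
- rewrite count_v_same_half//; last by lia.
  rewrite count_bowtie_left//; first by have := IH a b n3; rewrite a_low b_low; lia.
    by move=> r rR; rewrite !(mem_Rn n)//; lia.
  by move=> r rR; rewrite !(mem_shift_Rn n)//; lia.
- have [||v_ab _] := count_v_cross n a b; [lia..|].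
  have [|||r_ab _] := count_bowtie_cross a b (2 * n - 1) _ _ eqR.
  + by rewrite size_Rn//; lia.
  + by move=> r rR; rewrite !(mem_Rn n)//; lia.
  + by move=> r rR; rewrite !(mem_shift_Rn n)//; lia.
  move: ab; rewrite v_ab r_ab /arrowG arrowE//; last by lia.
  have -> : a < b by lia.
  by case: odd => //; lia.
- have [||_ v_ba] := count_v_cross n b a; [lia..|].
  have [|||_ r_ba] := count_bowtie_cross b a (2 * n - 1) _ _ eqR.
  + by rewrite size_Rn//; lia.
  + by move=> r rR; rewrite !(mem_Rn n)//; lia.
  + by move=> r rR; rewrite !(mem_shift_Rn n)//; lia.
  move: ab; rewrite v_ba r_ba /arrowG eq_sym arrowE//; last by lia.
  have -> : (a < b) = false by lia.
  by rewrite addnC; case: odd => //; lia.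
- rewrite count_v_same_half//; last by lia.
  rewrite count_bowtie_right//.
  + rewrite -(subnK (ltnW a_up)) -(subnK (ltnW b_up)) count_map.
    rewrite (eq_count (a2 := precedes (a - 2 ^ n) (b - 2 ^ n))); last first.
      by move=> r; apply: precedes_map; exact: addIn.
    have := IH (a - 2 ^ n) (b - 2 ^ n) n3.
    rewrite -(arrowG_add _ _ k) -?k8 ?subnK//; [|lia..].
    by move=> h; have := h _ _ ab; lia.
  + by move=> r rR; rewrite !(mem_Rn n)//; lia.
  + by move=> r rR; rewrite !(mem_shift_Rn n)//; lia.
Qed.
End majority.

(** * Elections as functions of the ballot sequence *)

Section elections.
Local Open Scope nat_scope.
Implicit Types (n l : nat) (s : seq nat).

(* A ballot sequence [s] lists the (1-based) rows selected by the voters. *)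
Definition election n s : profile :=
  flatten [seq nseq (count_mem l s) (nth [::] (Rn n) l.-1)
          | l <- iota 1 (4 * n - 2)].

(** Double counting: [election] groups the ballots by row, and each valid ballot falls into exactly
    one group. *)
Lemma count_election n s (p : pred (seq nat)) :
  all (fun l => 1 <= l <= 4 * n - 2) s ->
  count p (election n s) = count (fun l => p (nth [::] (Rn n) l.-1)) s.
Proof.
move=> /allP sV; rewrite count_flatten -map_comp sumnE big_map.
under eq_bigr do rewrite /= count_nseq -sum1_count big_mkcond big_distrr/=.
rewrite exchange_big -sum1_count [RHS]big_mkcond/=.
apply: eq_big_seq => l /sV lL.
have lI : l \in iota 1 (4 * n - 2) by rewrite mem_iota; lia.
rewrite (bigD1_seq l)//= ?iota_uniq// eqxx big1 => [|i /negbTE il].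
  by case: (p _).
by rewrite eq_sym il muln0.
Qed.

Lemma size_election n s : all (fun l => 1 <= l <= 4 * n - 2) s ->
  size (election n s) = size s.
Proof. by move=> sV; rewrite -count_predT count_election// count_predT. Qed.

(** Ties count as a loss, since the majority graph asks for strictly more than half. *)
Definition arrow_lost n a b : set (seq nat) :=
  [set s | 2 * count (precedes a b) (election n s) <= size (election n s)].

Lemma wrong_graph n s :
  majority_graph (initial_segment (2 ^ n)) (election n s) <> G n ->
  exists a b, [/\ initial_segment (2 ^ n) a, initial_segment (2 ^ n) b,
                  arrowG a b & arrow_lost n a b s].
Proof.
apply: contra_notP => kept.
have {}kept a b : initial_segment (2 ^ n) a -> initial_segment (2 ^ n) b ->
    arrowG a b -> size (election n s) < 2 * count (precedes a b) (election n s).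
  by move=> aV bV ab; rewrite ltnNge; apply/negP => lost; apply: kept; exists a, b.
congr Digraph; apply/seteqP; split => -[a b] /= [aV bV]; last first.
  move=> ab; split=> //; first by apply: contraTneq ab => ->; rewrite arrowG_irrefl.
  exact: kept.
(* A spurious arrow would face its reverse, which is an arrow of [G n] and is kept; two opposite
   strict majorities cannot coexist. *)
move=> ab maj; split=> //; apply: contraT => ab'.
have ba : arrowG b a.
  have [a1 _] := andP aV; have [b1 _] := andP bV.
  by have := arrowG_total _ _ a1 b1 ab; rewrite (negbTE ab').
have := kept _ _ bV aV ba.
have : count (precedes a b) (election n s) + count (precedes b a) (election n s)
    <= size (election n s).
  rewrite -(count_predC (precedes a b)) leq_add2l; apply: sub_count => r /=.
  exact: precedes_asym.
lia.
Qed.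
End elections.

(** * The Poisson probability generating function *)

Lemma poisson_pgf {R : realType} (lambda theta : R) : 0 < lambda -> 0 <= theta ->
  (\sum_(0 <= m <oo) (poisson_pmf lambda m * theta ^+ m)%:E =
   (expR (lambda * (theta - 1)))%:E)%E.
Proof.
move=> lambda_gt0 theta_ge0; under eq_eseriesr => m _.
  rewrite /poisson_pmf lambda_gt0 [X in X%:E](_ : _ =
    expR (- lambda) * ((lambda * theta) ^+ m / m`!%:R)); last first.
    by rewrite exprMn; ring.
  rewrite EFinM; over.
rewrite /= nneseriesZl/=; last first.
  by move=> m _; rewrite lee_fin divr_ge0// exprn_ge0// mulr_ge0// ltW.
rewrite mulrBr mulr1 addrC expRD EFinM; congr (_ * _)%E.
rewrite -[RHS]/((limn (series (exp_coeff (lambda * theta))))%:E).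
rewrite -(EFin_lim (is_cvg_series_exp_coeff _)).
by apply/congr_lim/funext => n; rewrite /= /series/= -sumEFin.
Qed.

(** * The random ballot sequence and its law *)

Section ballots.
Context {d : measure_display} {T : measurableType d} {R : realType}.
Variable P : probability T R.
Implicit Types (N : {RV P >-> nat}) (X : nat -> {RV P >-> nat}).

Definition ballots N X (w : T) : seq nat := mkseq (fun k => X k w) (N w).

Lemma votesE N X l w : votes N X l w = count_mem l (ballots N X w).
Proof.
rewrite /votes count_map -sum1_count [RHS]big_mkcond/=.
by rewrite -[in RHS](subn0 (N w)) big_mkord.
Qed.

Lemma random_profileE n N X w : random_profile n N X w = election n (ballots N X w).
Proof. by congr flatten; apply: eq_map => l; rewrite votesE. Qed.

(** Names the family whose independence [poisson_voting] asserts. *)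
Definition ballot_or_count N X (i : option nat) : {RV P >-> nat} :=
  if i is Some k then X k else N.

(** Fixing the ballot sequence constrains only the count [N] and the first [size s] choices, so
    independence applies to this finite intersection. *)
Lemma ballots_preimage1 N X s : ballots N X @^-1` [set s] =
  \bigcap_(i in [set` None :: map Some (iota 0 (size s))])
    (ballot_or_count N X i @^-1`
      [set (if i is Some k then nth 0%N s k else size s)]).
Proof.
apply/seteqP; split => w /=.
  move=> <- [k|]; rewrite /= !inE ?size_mkseq//= mem_map; last exact: Some_inj.
  by rewrite mem_iota => kN; rewrite nth_mkseq.
move=> ws; have Ns : N w = size s by apply: (ws None); rewrite /= mem_head.
apply: (@eq_from_nth _ 0%N); rewrite size_mkseq// => k kN; rewrite nth_mkseq//.
apply: (ws (Some k)); rewrite /= inE mem_map; last exact: Some_inj.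
by rewrite mem_iota -Ns.
Qed.

Lemma measurable_ballots N X (Q : set (seq nat)) : measurable (ballots N X @^-1` Q).
Proof.
(* There are countably many ballot sequences, so every event is a countable union of singleton
   preimages. *)
rewrite [A in measurable A](_ : _ =
    \bigcup_s if `[< Q s >] then ballots N X @^-1` [set s] else set0).
  apply: countable_bigcupT_measurable => // s; case: asboolP => // _.
  rewrite ballots_preimage1; apply: fin_bigcap_measurable; first exact: finite_seq.
  by move=> i _; rewrite -[A in measurable A]setTI; exact: measurable_funP.
apply/seteqP; split => w /= => [Qw|[s _]].
  by exists (ballots N X w) => //; rewrite asboolT.
by case: asboolP => // Qs /= ->.
Qed.

Lemma probability_bigsetU (I : Type) (r : seq I) (p : pred I) (A : I -> set T) :
  (forall i, measurable (A i)) ->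
  (P (\big[setU/set0]_(i <- r | p i) A i) <= \sum_(i <- r | p i) P (A i))%E.
Proof.
move=> mA; pose bounded B x := measurable B /\ (P B <= x)%E.
suff [] : bounded (\big[setU/set0]_(i <- r | p i) A i)
  (\sum_(i <- r | p i) P (A i))%E by [].
apply: (big_ind2 bounded) => [|B x C y [mB Bx] [mC Cy]|i _].
- by split=> //; rewrite measure0.
- split; first exact: measurableU.
  by apply: (@le_trans _ _ (P B + P C)%E); [exact: measureU2|exact: leeD].
- by split.
Qed.

Variables (lambda : R) (L : nat) (N : {RV P >-> nat}) (X : nat -> {RV P >-> nat}).
Hypotheses (lambda_gt0 : 0 < lambda) (L_gt0 : (0 < L)%N).
Hypothesis voting : poisson_voting lambda L N X.

Let valid (s : seq nat) := all (fun l => 1 <= l <= L)%N s.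

Lemma probability_ballots s : valid s ->
  P (ballots N X @^-1` [set s]) =
    (poisson_pmf lambda (size s) * L%:R ^- size s)%:E.
Proof.
case: voting => pN pX indep /allP sL; rewrite ballots_preimage1.
rewrite [LHS](indep _ (fun i =>
  [set (if i is Some k then nth 0%N s k else size s)])).
- rewrite big_cons/= pN big_map EFinM; congr (_ * _)%E.
  rewrite big_seq (eq_bigr (fun=> (L%:R^-1)%:E)) => [|k].
    by rewrite -big_seq prodEFin big_const_seq count_predT size_iota
      iter_mulr_1 exprVn.
  by rewrite mem_iota/= => ks; rewrite pX// sL// mem_nth.
- rewrite /= (map_inj_uniq (@Some_inj _)) iota_uniq andbT.
  by apply/negP => /mapP[].
- by [].
Qed.

(** The [L] admissible values, of probability [1/L] each, exhaust the total mass, so each voter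
    picks another value with probability zero; a countable union over voters stays negligible. *)
Lemma invalid_ballots : P (ballots N X @^-1` [set s | ~~ valid s]) = 0%E.
Proof.
case: voting => _ pX _.
have mX k (A : set nat) : measurable (X k @^-1` A).
  by rewrite -[B in measurable B]setTI; exact: measurable_funP.
have pX0 k : P (X k @^-1` [set l | ~~ (1 <= l <= L)%N]) = 0%E.
  rewrite [A in P A](_ : _ =
    ~` \big[setU/set0]_(l < L) X k @^-1` [set l.+1]); last first.
    rewrite -(bigcup_mkord _ (fun l => X k @^-1` [set l.+1])).
    apply/seteqP; split => w /=; last first.
      apply: contra_notN => /andP[X1 XL].
      by exists (X k w).-1 => /=; rewrite prednK.
    by move=> /negP XV [l /= lL Xl]; apply: XV; rewrite Xl.
  rewrite probability_setC; last exact: bigsetU_measurable.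
  rewrite measure_bigsetU_ord//; last first.
    by move=> i j _ _ [w [/= -> /eqP]]; rewrite eqSS => /eqP/val_inj.
  rewrite (eq_bigr (fun=> (L%:R^-1)%:E)) => [|l _];
    last exact: (pX k l.+1 (ltn_ord l)).
  rewrite sumEFin sumr_const card_ord -(mulr_natl L%:R^-1) divff ?subee//.
  by rewrite pnatr_eq0 -lt0n.
apply/negligibleP; first exact: measurable_ballots.
apply: (@negligibleS _ _ _ _ (\bigcup_k X k @^-1` [set l | ~~ (1 <= l <= L)%N])).
  move=> w /= /allPn[l /mapP[k _ ->] Xk]; by exists k.
by apply: negligible_bigcup => k; apply/negligibleP; [exact: mX|exact: pX0].
Qed.

(** A Markov-type bound: on valid sequences the product of weights dominates the indicator of [Q],
    and its expectation is the Poisson generating function at the mean weight. *)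
Lemma probability_ballots_le (Q : set (seq nat)) (u : nat -> R) :
  (forall l, 0 <= u l) ->
  (forall s, Q s -> valid s -> 1 <= \prod_(l <- s) u l) ->
  (P (ballots N X @^-1` Q) <=
    (expR (lambda * ((\sum_(1 <= l < L.+1) u l) / L%:R - 1)))%:E)%E.
Proof.
move=> u0 Qu.
set theta := _ / _.
have theta_ge0 : 0 <= theta by rewrite divr_ge0// sumr_ge0.
(* Valid sequences of length [m] are encoded by functions into ['I_L]; the successor makes row
   numbers 1-based. *)
pose votes_of m (f : {ffun 'I_m -> 'I_L}) := [seq (f i : nat).+1 | i <- enum 'I_m].
have valid_of m (f : {ffun 'I_m -> 'I_L}) : valid (votes_of m f).
  by apply/allP => _ /mapP[i _ ->]; rewrite ltn_ord.
have PQ m : (P (ballots N X @^-1` [set s | Q s /\ size s = m]) <=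
    (poisson_pmf lambda m * theta ^+ m)%:E)%E.
  pose A (f : {ffun 'I_m -> 'I_L}) := ballots N X @^-1` [set votes_of m f].
  have mA f : measurable (A f) by exact: measurable_ballots.
  pose Qf (f : {ffun 'I_m -> 'I_L}) := `[< Q (votes_of m f) >].
  apply: (@le_trans _ _ (P (\big[setU/set0]_(f | Qf f) A f))).
    apply: (@le_trans _ _ (P ((\big[setU/set0]_(f | Qf f) A f) `|`
        ballots N X @^-1` [set s | ~~ valid s]))).
      apply: le_measure; rewrite ?inE; [exact: measurable_ballots| |].
        by apply: measurableU; [exact: bigsetU_measurable|exact: measurable_ballots].
      move=> w /= [Qw Nw].
      have [/allP wL|] := boolP (valid (ballots N X w)); last by right.
      left; pose f := [ffun i : 'I_m =>
        insubd (Ordinal L_gt0) (nth 0%N (ballots N X w) i).-1].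
      have fE : ballots N X w = votes_of m f.
        apply: (@eq_from_nth _ 0%N) => [|i].
          by rewrite Nw size_map size_enum_ord.
        move=> iN; have /wL/andP[l1 lL] := mem_nth 0%N iN.
        have im : (i < m)%N by rewrite -Nw.
        rewrite (nth_map (Ordinal im)) ?size_enum_ord//.
        rewrite (nth_ord_enum (Ordinal im) (Ordinal im)).
        by rewrite ffunE val_insubd /= (_ : (_ < L)%N) ?prednK// prednK.
      by rewrite (bigD1 f)/=; [left|apply/asboolP; rewrite -fE].
    rewrite measureU0//;
      [exact: bigsetU_measurable|exact: measurable_ballots|exact: invalid_ballots].
  apply: le_trans (probability_bigsetU _ _ _ _ mA) _.
  apply: (@le_trans _ _ (\sum_(f | Qf f) (poisson_pmf lambda m *
      \prod_(i < m) (u (f i).+1 / L%:R))%:E)%E).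
    apply: lee_sum => f /asboolP Qf_; rewrite probability_ballots//.
    have sz : size (votes_of m f) = m by rewrite size_map size_enum_ord.
    rewrite sz lee_fin ler_wpM2l ?poisson_pmf_ge0//.
    rewrite big_split/= prodr_const card_ord exprVn ler_peMl ?invr_ge0 ?exprn_ge0//.
    by have := Qu _ Qf_ (valid_of _ f); rewrite big_map big_enum.
  rewrite sumEFin lee_fin -mulr_sumr ler_wpM2l ?poisson_pmf_ge0//.
  have -> : theta ^+ m = \prod_(i < m) \sum_(l < L) (u l.+1 / L%:R).
    by rewrite prodr_const card_ord -mulr_suml /theta big_add1/= big_mkord.
  (* Expanding the power gives a sum over all functions [f]; those outside [Q] contribute
     nonnegative terms. *)
  rewrite bigA_distr_bigA/= [leRHS](bigID Qf)/= lerDl sumr_ge0// => f _.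
  by apply: prodr_ge0 => i _; rewrite divr_ge0.
rewrite -poisson_pgf//.
pose B m := ballots N X @^-1` [set s | Q s /\ size s = m].
have QB : ballots N X @^-1` Q `<=` \bigcup_m B m.
  by move=> w Qw; exists (size (ballots N X w)).
have mB m : measurable (B m) by exact: measurable_ballots.
apply: le_trans (measure_sigma_subadditive _ mB (measurable_ballots N X Q) QB) _.
by apply: lee_nneseries => m _ //; exact: PQ.
Qed.
End ballots.

(** * Sums and products of two-valued weights *)

Section two_weights.
Variables (R : realType) (S : Type) (p : pred S) (x y : R).

Lemma sum_two_weights s : \sum_(i <- s) (if p i then x else y) =
  (count p s)%:R * x + (count (predC p) s)%:R * y.
Proof.
elim: s => [|i s IH]; first by rewrite big_nil !mul0r addr0.
by rewrite big_cons IH /=; case: (p i) => /=; rewrite !natrD; ring.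
Qed.

Lemma prod_two_weights s : \prod_(i <- s) (if p i then x else y) =
  x ^+ count p s * y ^+ count (predC p) s.
Proof.
elim: s => [|i s IH]; first by rewrite big_nil mulr1.
by rewrite big_cons IH /=; case: (p i) => /=; rewrite ?exprS; ring.
Qed.
End two_weights.

(** * Probability of losing one arrow, then of any failure *)

Section failure_bound.
Context {d : measure_display} {T : measurableType d} {R : realType}.
Variables (P : probability T R) (lambda : R) (n : nat).
Variables (N : {RV P >-> nat}) (X : nat -> {RV P >-> nat}).
Hypotheses (lambda_gt0 : 0 < lambda) (n_ge3 : (3 <= n)%N).
Hypothesis voting : poisson_voting lambda (4 * n - 2) N X.

Lemma measurable_failure : measurable (failure n N X).
Proof.
rewrite /failure; under eq_set do rewrite /random_graph random_profileE.
exact: (measurable_ballots P N X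
  [set s | majority_graph (initial_segment (2 ^ n)) (election n s) <> G n]).
Qed.

Lemma probability_arrow_lost a b :
  initial_segment (2 ^ n)%N a -> initial_segment (2 ^ n)%N b -> arrowG a b ->
  (P (ballots P N X @^-1` arrow_lost n a b) <=
    (expR (- (lambda / (8 * n%:R ^+ 2))))%:E)%E.
Proof.
move=> aV bV ab.
have n1 : 3%:R <= n%:R :> R by rewrite ler_nat.
(* The optimal weight is [sqrt ((n - 1) / n)]; this rational approximation
   already gives [theta - 1 = - 1 / (2 (2 n - 1)^2)]. *)
pose r : R := (2 * n%:R - 1) / (2 * n%:R).
have r0 : 0 < r by rewrite divr_gt0//; lra.
have r1 : r <= 1 by rewrite ler_pdivrMr; lra.
pose p l := precedes a b (nth [::] (Rn n) l.-1).
pose u l := if p l then r else r^-1.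
have u_ge0 l : 0 <= u l by rewrite /u; case: (p l); rewrite ?invr_ge0 ltW.
have L_gt0 : (0 < 4 * n - 2)%N by lia.
have u_lost s : arrow_lost n a b s -> all (fun l => 1 <= l <= 4 * n - 2)%N s ->
    1 <= \prod_(l <- s) u l.
  (* A lost arrow has at least as many opposing as supporting votes, so after cancelling [r] against
     [r^-1] only powers of [r^-1 >= 1] remain. *)
  rewrite /arrow_lost/= => + sV; rewrite count_election// size_election//.
  rewrite -(count_predC p) mul2n -addnn leq_add2l => pC.
  rewrite prod_two_weights -(subnKC pC) exprD mulrA -exprMn divff ?gt_eqF//.
  by rewrite expr1n mul1r exprn_ege1// invf_ge1.
apply: le_trans (probability_ballots_le P lambda _ N X
  lambda_gt0 L_gt0 voting _ u u_ge0 u_lost) _.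
rewrite lee_fin ler_expR -mulrN ler_pM2l//.
have -> : \sum_(1 <= l < (4 * n - 2).+1) u l =
    \sum_(row <- Rn n) (if precedes a b row then r else r^-1).
  by rewrite big_add1/= (big_nth [::]) size_Rn.
rewrite sum_two_weights.
have := count_arrow _ _ _ n_ge3 aV bV ab.
have := count_predC (precedes a b) (Rn n); rewrite size_Rn//.
set c := count (precedes a b) _; set c' := count _ _ => cc' c2.
have n2 : (2 <= 4 * n)%N by lia.
have L_E : (4 * n - 2)%:R = 4 * n%:R - 2 :> R by rewrite natrB ?natrM.
have c'E : c'%:R = 4 * n%:R - 2 - c%:R :> R.
  by rewrite -L_E -cc' natrD; ring.
have c2' : 2 * n%:R <= c%:R :> R by rewrite -natrM ler_nat.
(* Since [r <= r^-1], the mean weight is largest at the minimal support [2 * n]. *)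
have c_le : c%:R * r + c'%:R / r <= 2 * n%:R * r + (2 * n%:R - 2) / r.
  have r_le : r <= r^-1 by rewrite (le_trans r1)// invf_ge1.
  rewrite c'E -subr_ge0.
  rewrite [leRHS](_ : _ = (c%:R - 2 * n%:R) * (r^-1 - r)); last by ring.
  by rewrite mulr_ge0// subr_ge0.
rewrite L_E; apply: (@le_trans _ _
    ((2 * n%:R * r + (2 * n%:R - 2) / r) / (4 * n%:R - 2) - 1)).
  by rewrite lerD2r ler_pM2r// invr_gt0; lra.
rewrite [leLHS](_ : _ = - (2 * (2 * n%:R - 1) ^+ 2)^-1).
  rewrite lerN2 lef_pV2 ?posrE; [nra|nra|].
  by rewrite mulr_gt0// exprn_gt0//; lra.
rewrite /r; field; rewrite -?andbA; repeat (apply/andP; split); lra.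
Qed.

Lemma probability_failure_le : (P (failure n N X) <=
  (4 ^+ n * expR (- (lambda / (8 * n%:R ^+ 2))))%:E)%E.
Proof.
(* Ordinals start at 0 and candidates at 1, hence the successors; pairs that are not arrows get the
   empty event. *)
pose lost (e : 'I_(2 ^ n) * 'I_(2 ^ n)) :=
  if arrowG e.1.+1 e.2.+1 then arrow_lost n e.1.+1 e.2.+1 else set0.
pose A e := ballots P N X @^-1` lost e.
have mA e : measurable (A e) by exact: measurable_ballots.
apply: (@le_trans _ _ (P (\big[setU/set0]_e A e))).
  apply: le_measure; rewrite ?inE.
  - exact: measurable_failure.
  - exact: bigsetU_measurable.
  move=> w; rewrite /failure/= /random_graph random_profileE.
  move=> /wrong_graph[a [b [/andP[a1 aV] /andP[b1 bV] ab lost_ab]]].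
  have a2 : (a.-1 < 2 ^ n)%N by rewrite prednK.
  have b2 : (b.-1 < 2 ^ n)%N by rewrite prednK.
  rewrite (bigD1 (Ordinal a2, Ordinal b2))//=; left.
  by rewrite /A /lost /= !prednK// ab.
apply: le_trans (probability_bigsetU _ _ _ _ _ mA) _.
pose B := expR (- (lambda / (8 * n%:R ^+ 2))).
apply: (@le_trans _ _ (\sum_(e : 'I_(2 ^ n) * 'I_(2 ^ n)) B%:E)%E).
  apply: lee_sum => e _; rewrite /A /lost; case: ifPn => ab.
    by apply: probability_arrow_lost; rewrite // /initial_segment/= ltn_ord.
  by rewrite preimage_set0 measure0 lee_fin expR_ge0.
rewrite sumEFin sumr_const card_prod card_ord -expnMn.
by rewrite -[B *+ _]mulr_natl natrX.
Qed.
End failure_bound.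

(** * Asymptotics in $n$ *)

Lemma lt_limn_einf (R : realType) (u : nat -> R) (a : R) :
  (a%:E < limn_einf (fun n => (u n)%:E))%E ->
  exists c n0, a < c /\ forall n, (n0 <= n)%N -> c <= u n.
Proof.
(* The lower limit is the supremum of the tail infima, so some tail infimum exceeds [a]; it is
   finite, being also at most [u n0]. *)
rewrite limn_einf_lim (cvg_lim _ (@cvg_einfs_sup _ _))//.
move=> /ereal_sup_gt[_ [n0 _ <-]].
set e := einfs _ _ => ae.
have e_le n : (n0 <= n)%N -> (e <= (u n)%:E)%E.
  by move=> nn; apply: ereal_inf_lbound; exists n.
have e_fin : e \is a fin_num.
  rewrite fin_real// (lt_trans (ltNyr a) ae).
  exact: le_lt_trans (e_le n0 (leqnn _)) (ltry _).
exists (fine e), n0; rewrite -lte_fin fineK//; split=> // n /e_le.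
by rewrite -[e]fineK.
Qed.

Theorem theorem4 (R : realType) (lambda : nat -> R)
  (d : nat -> measure_display) (T : forall n : nat, measurableType (d n))
  (P : forall n : nat, probability (T n) R)
  (N : forall n : nat, {RV (P n) >-> nat})
  (X : forall n : nat, nat -> {RV (P n) >-> nat})
  (lambda_gt0 : forall n : nat, (3 <= n)%N -> 0 < lambda n)
  (voting : forall n : nat, (3 <= n)%N ->
     poisson_voting (lambda n) (4 * n - 2) (N n) (X n))
  (liminf_gt :
     ((16%:R * ln 2%:R)%:E <
      limn_einf (fun n : nat => (lambda n / n%:R ^+ 3)%:E))%E) :
  (exists K beta : R, [/\ 0 < K, 0 < beta &
     forall n : nat, (3 <= n)%N ->
       (P n (failure n (N n) (X n)) < (K * expR (- beta * n%:R))%:E)%E]) /\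
  P n (failure n (N n) (X n)) @[n --> \oo] --> 0%E.
Proof.
have [c [n0 [c16 c_le]]] := lt_limn_einf _ _ _ liminf_gt.
(* The exponent $\lambda_n/(8n^2)$ is at least $cn/8$, while the union bound costs $2n\ln 2$; the
   rate is positive exactly because $c > 16\ln 2$. *)
pose beta := c / 8 - 2 * ln 2.
have beta_gt0 : 0 < beta by rewrite /beta; lra.
have P_le n : (3 <= n)%N -> (n0 <= n)%N ->
    (P n (failure n (N n) (X n)) <= (expR (- beta * n%:R))%:E)%E.
  move=> n3 nn0; have n_gt0 : 0 < n%:R :> R by rewrite ltr0n; lia.
  apply: le_trans
    (probability_failure_le _ _ _ _ _ (lambda_gt0 n n3) n3 (voting n n3)) _.
  have -> : 4 ^+ n = expR (n%:R * (2 * ln 2)) :> R.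
    rewrite mulrC expRM_natr; congr (_ ^+ n).
    by rewrite expRM_natl lnK ?posrE//; ring.
  rewrite lee_fin -expRD ler_expR /beta.
  suff : c / 8 * n%:R <= lambda n / (8 * n%:R ^+ 2) by lra.
  have := c_le n nn0; rewrite ler_pdivlMr ?exprn_gt0// => cn.
  rewrite ler_pdivlMr ?mulr_gt0 ?exprn_gt0//.
  by rewrite (le_trans _ cn)// le_eqVlt; apply/orP; left; apply/eqP; field.
split.
  (* The exponential term makes the bound exceed 1 for the finitely many [n < n0]; the added 1 makes
     the inequality strict. *)
  exists (expR (beta * n0%:R) + 1), beta; split=> [|//|n n3].
    by rewrite addr_gt0 ?expR_gt0.
  have [nn0|nn0] := leqP n0 n.
    apply: le_lt_trans (P_le n n3 nn0) _; rewrite lte_fin.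
    by rewrite ltr_pMl ?expR_gt0// ltrDr expR_gt0.
  apply: (@le_lt_trans _ _ 1%E).
    exact/probability_le1/measurable_failure.
  rewrite lte_fin mulrDl mul1r -expRD.
  rewrite (@lt_le_trans _ _ (1 + expR (- beta * n%:R)))//.
    by rewrite ltrDl expR_gt0.
  rewrite lerD2r -[leLHS]expR0 ler_expR mulNr subr_ge0 ler_pM2l// ler_nat;
    exact: ltnW.
apply: (@squeeze_cvge _ _ _ _ (fun=> 0%E) _ (fun n => (expR (- beta * n%:R))%:E)).
- near=> n; rewrite measure_ge0 P_le//; near: n; exact: nbhs_infty_ge.
- exact: cvg_cst.
- rewrite (_ : (fun n => _) = EFin \o geometric 1 (expR (- beta))); last first.
    by apply/funext => n; rewrite /= mul1r expRM_natr.
  apply: cvg_EFin; first by near=> n.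
  by apply: cvg_geometric; rewrite ger0_norm ?expR_ge0// expR_lt1 oppr_lt0.
Unshelve. all: by end_near. Qed.
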